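(* There exists a compactification $\gamma\omega$ of $\omega$ which is not smooth, which is first-countable, and whose remainder $\gamma\omega\setminus\omega$ is separable.
   Context: $\omega$ is the discrete space of natural numbers; compactifications are Hausdorff. $C(K)$ is the Banach space of real-valued continuous functions on a compact space $K$ with the supremum norm. For a compactification $\gamma\omega$ of $\omega$, the natural copy of $c_0$ in $C(\gamma\omega)$ is the closed subspace $\{f\in C(\gamma\omega): f|(\gamma\omega\setminus\omega)\equiv 0\}$. The compactification $\gamma\omega$ is called smooth if the natural copy of $c_0$ is complemented in $C(\gamma\omega)$, i.e. is the range of a bounded linear projection on $C(\gamma\omega)$. *)

(* Defs.v *)
From HB Require Import structures.
From mathcomp Require Import all_boot all_order all_algebra.
From mathcomp Require Import all_classical all_reals all_analysis.

Set Implicit Arguments.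
Unset Strict Implicit.
Unset Printing Implicit Defensive.

Import Order.TTheory GRing.Theory Num.Theory.
Import numFieldNormedType.Exports.

Local Open Scope classical_set_scope.
Local Open Scope ring_scope.

Definition separable (T : topologicalType) : Prop :=
  exists2 D : set T, countable D & dense D.

Definition first_countable (T : topologicalType) : Prop :=
  forall x : T, exists2 B : set_system T,
    countable B & B `<=` nbhs x /\ filter_from B id --> x.

(* [comp_embed] is a homeomorphism onto its image: it is injective and [X]
   carries the initial topology for it. *)
Record compactification (X : topologicalType) := Compactification {
  comp_space :> topologicalType ;
  comp_embed : X -> comp_space ;
  comp_compact : compact [set: comp_space] ;
  comp_hausdorff : hausdorff_space comp_space ;
  comp_inj : injective comp_embed ;
  comp_initial : @open X = @open (initial_topology comp_embed) ;
  comp_dense : dense (range comp_embed) }.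

Definition remainder (X : topologicalType) (gX : compactification X) : set gX :=
  ~` range (@comp_embed X gX).
Arguments remainder {X} gX.

(* The compactness proof is a parameter because the supremum norm below is a
   norm only when every continuous function is bounded ([sup] is 0 on
   unbounded sets). *)
Definition Cspace (R : realType) (K : topologicalType)
  (cK : compact [set: K]) : Type := continuousType K R.

Section Cspace.
Context (R : realType) (K : topologicalType) (cK : compact [set: K]).
Local Notation CK := (Cspace R cK).
Implicit Types f g h : continuousType K R.

HB.instance Definition _ := Choice.copy CK (continuousType K R).

Let Czero_continuous : continuous (fun _ : K => 0 : R).
Proof. by move=> x; exact: cvg_cst. Qed.
Let Copp_continuous f : continuous (fun x => - f x).
Proof. by move=> x; apply: cvgN; exact: (@cts_fun _ _ f). Qed.
Let Cadd_continuous f g : continuous (fun x => f x + g x).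
Proof. by move=> x; apply: cvgD; exact: cts_fun. Qed.
Let Cscale_continuous (a : R) f : continuous (fun x => a * f x).
Proof. by move=> x; apply: cvgMr; exact: (@cts_fun _ _ f). Qed.

Definition Czero : CK := mkcts Czero_continuous : continuousType K R.
Definition Copp (f : CK) : CK := mkcts (@Copp_continuous f) : continuousType K R.
Definition Cadd (f g : CK) : CK :=
  mkcts (@Cadd_continuous f g) : continuousType K R.
Definition Cscale (a : R) (f : CK) : CK :=
  mkcts (@Cscale_continuous a f) : continuousType K R.

Let CDA : associative Cadd.
Proof. by move=> f g h; apply/continuousEP => x; exact: addrA. Qed.
Let CDC : commutative Cadd.
Proof. by move=> f g; apply/continuousEP => x; exact: addrC. Qed.
Let CD0 : left_id Czero Cadd.
Proof. by move=> f; apply/continuousEP => x; exact: add0r. Qed.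
Let CDN : left_inverse Czero Copp Cadd.
Proof. by move=> f; apply/continuousEP => x; exact: addNr. Qed.

HB.instance Definition _ := GRing.isZmodule.Build CK CDA CDC CD0 CDN.

Let CZA (a b : R) (f : CK) : Cscale a (Cscale b f) = Cscale (a * b) f.
Proof. by apply/continuousEP => x; exact: mulrA. Qed.
Let CZ1 : left_id 1 Cscale.
Proof. by move=> f; apply/continuousEP => x; exact: mul1r. Qed.
Let CZDr : right_distributive Cscale +%R.
Proof. by move=> a f g; apply/continuousEP => x; exact: mulrDr. Qed.
Let CZDl (f : CK) : {morph Cscale^~ f : a b / a + b}.
Proof. by move=> a b; apply/continuousEP => x; exact: mulrDl. Qed.

HB.instance Definition _ := GRing.Zmodule_isLmodule.Build R CK CZA CZ1 CZDr CZDl.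

Definition sup_norm f : R := sup (range (fun x => `|f x|)).

Lemma has_ubound_norm f : has_ubound (range (fun x => `|f x|)).
Proof.
have [K0|/set0P[x0 _]] := eqVneq [set: K] set0.
  by exists 0 => _ [x _ <-]; have : [set: K] x by []; rewrite K0.
have cf : continuous (fun x => `|f x|).
  by move=> x; apply: cvg_norm; exact: (@cts_fun _ _ f).
have [//|x _ fx] := @compact_EVT_max K R _ setT _ cK (continuous_subspaceT cf).
  by exists x0.
by exists `|f x| => _ [y _ <-]; exact/fx/in_setT.
Qed.

Lemma sup_norm_ub f x : `|f x| <= sup_norm f.
Proof. by apply: ub_le_sup; [exact: has_ubound_norm|exists x]. Qed.

Lemma sup_norm_le f (M : R) : 0 <= M -> (forall x, `|f x| <= M) ->
  sup_norm f <= M.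
Proof.
move=> M0 fM; rewrite /sup_norm.
have [->|/set0P ne] := eqVneq (range (fun x => `|f x|)) set0.
  by rewrite sup0.
by apply: ge_sup => // _ [x _ <-].
Qed.

Lemma sup_norm_ge0 f : 0 <= sup_norm f.
Proof.
rewrite /sup_norm.
have [->|/set0P[_ [x _ _]]] := eqVneq (range (fun x => `|f x|)) set0.
  by rewrite sup0.
exact: le_trans (sup_norm_ub f x).
Qed.

Let sup_normD (f g : CK) : sup_norm (f + g) <= sup_norm f + sup_norm g.
Proof.
apply: sup_norm_le => [|x]; first by rewrite addr_ge0// sup_norm_ge0.
by apply: le_trans (ler_normD _ _) _; apply: lerD; exact: sup_norm_ub.
Qed.

Let sup_normZ_le (a : R) (f : CK) : sup_norm (a *: f) <= `|a| * sup_norm f.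
Proof.
apply: sup_norm_le => [|x]; first by rewrite mulr_ge0// sup_norm_ge0.
by rewrite [leLHS]normrM ler_wpM2l// sup_norm_ub.
Qed.

Let sup_normZ (a : R) (f : CK) : sup_norm (a *: f) = `|a| * sup_norm f.
Proof.
apply/eqP; rewrite eq_le sup_normZ_le/=.
have [->|a0] := eqVneq a 0; first by rewrite normr0 mul0r sup_norm_ge0.
have := sup_normZ_le a^-1 (a *: f).
by rewrite scalerA mulVf// scale1r normfV ler_pdivlMl ?normr_gt0.
Qed.

Let sup_norm0_eq0 (f : CK) : sup_norm f = 0 -> f = 0.
Proof.
move=> f0; apply/continuousEP => x; apply/eqP.
by have := sup_norm_ub f x; rewrite f0 normr_le0.
Qed.

HB.instance Definition _ :=
  Lmodule_isNormed.Build R CK sup_normD sup_normZ sup_norm0_eq0.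

End Cspace.

Definition complemented (R : realType) (V : normedModType R) (A : set V)
  : Prop :=
  exists P : {linear V -> V},
    [/\ exists M : R, forall v, `|P v| <= M * `|v|,
        forall v, P (P v) = P v
      & range P = A].

Definition c0_copy (R : realType) (X : topologicalType)
    (gX : compactification X) : set (Cspace R (@comp_compact X gX)) :=
  [set f | forall x, remainder gX x -> (f : continuousType gX R) x = 0].
Arguments c0_copy R {X} gX.

Definition smooth (R : realType) (X : topologicalType)
    (gX : compactification X) : Prop :=
  complemented (c0_copy R gX).
Arguments smooth R {X} gX.

(* Main.v *)
Require Import Defs.
From mathcomp Require Import all_boot all_order all_algebra.
From mathcomp Require Import all_classical all_reals all_analysis.
From mathcomp Require Import lra.

(* Identify [nat] with the nodes of the binary tree, and let [c x] say whether
   the branch [x] is eventually [1] at even places.  Compactify with the Boolean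
   algebra generated by the singletons, the cones, and for each branch [x] the
   set [A_x] of nodes lexicographically below [x], to which the branch [x]
   itself is added when [c x].  A point of the remainder is a branch [z] together
   with the bit telling whether it lies in the closure of [A_z], and these data
   give a countable base: the remainder is essentially a split Cantor set.

   If [P] were a projection onto [c_0], the functionals
   [nu_t f = f t - P f t] would vanish on [c_0] and be uniformly bounded.  For
   [y] close to [x], the indicators of [A_x] and [A_y] differ modulo [c_0] inside
   a small cone around [x]; disjointness of cones then bounds the number of points
   where [phi_t x = nu_t 1_(A_x)] oscillates by more than [1/4].  On the other
   hand [phi_(x|n) x] tends to [c x].  Since [c] takes both values in every cone,
   even off a countable set, a Baire-category fusion yields a branch along which
   this sequence oscillates. *)

Set Implicit Arguments.
Unset Strict Implicit.
Unset Printing Implicit Defensive.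

Import Order.TTheory GRing.Theory Num.Theory.
Import numFieldNormedType.Exports.

Local Open Scope classical_set_scope.

(** * Subspace topologies *)

Lemma nbhs_set_type (X : topologicalType) (A : set X) (x : set_type A)
    (U : set (set_type A)) :
  nbhs x U <-> exists2 V, nbhs (val x) V & val @^-1` V `<=` U.
Proof.
split=> [[_ [[V Vop <-] Vx VU]]|[V Vx VU]].
  by exists V => //; apply: open_nbhs_nbhs.
apply: filterS VU _.
exact: (@initial_continuous _ _ (val : set_type A -> X) x V Vx).
Qed.

Lemma compact_set_type (X : topologicalType) (A : set X) :
  compact A -> compact [set: set_type A].
Proof.
move=> cA F PF _.
have GA : F (val @^-1` A).
  by apply: (@filterS _ F _ setT) => [x _|]; [exact: set_valP|exact: filterT].
have [a [Aa aF]] := cA (val @ F) _ GA.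
exists (SigSub (mem_set Aa)); split=> // B V FB /nbhs_set_type[W aW WV].
have [] := aF (val @` B) W _ aW; first by apply: (@filterS _ F _ B) => // x Bx; exists x.
by move=> _ [[x Bx <-] Wx]; exists x; split=> //; exact: WV.
Qed.

Lemma hausdorff_set_type (X : topologicalType) (A : set X) :
  hausdorff_space X -> hausdorff_space (set_type A).
Proof.
move=> hX x y xy; apply/val_inj/hX => U V Ux Vy.
have [||z [Uz Vz]] := xy (val @^-1` U) (val @^-1` V).
- by apply/nbhs_set_type; exists U.
- by apply/nbhs_set_type; exists V.
- by exists (val z).
Qed.

(** * Closure of a family of points in a Cantor cube *)

Section BooleanClosure.
Variables (I : choiceType) (T : Type) (ev : T -> I -> bool).
Implicit Types (p q : I -> bool) (L : seq I).

Local Notation cube := (prod_topology (fun _ : I => bool)).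

Lemma nbhs_cube (p : cube) (U : set cube) :
  nbhs p U <-> exists L, forall q, map q L = map p L -> U q.
Proof.
split=> [|[L LU]].
- pose F := filter_from [set: seq I] (fun L => [set q : cube | map q L = map p L]).
  have FF : Filter F.
    apply: filter_from_filter; first by exists [::].
    move=> L1 L2 _ _; exists (L1 ++ L2) => //= q /=.
    by rewrite !map_cat => /eqP; rewrite eqseq_cat ?size_map// => /andP[/eqP ? /eqP].
  have Fp : F --> p.
    apply/cvg_sup => i A [B [[C Cop <-] /= Cp] CA].
    exists [:: i] => //= q [qi]; apply: CA => /=.
    by rewrite /= qi.
  by move=> /Fp[L _ LU]; exists L => q; exact: LU.
- apply: filterS LU _; elim: L => [|i L IH] /=; first exact: filterS filterT.
  have ip : nbhs p [set q : cube | q i = p i].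
    have /(_ _) := @proj_continuous I (fun=> bool) i p [set p i].
    by apply; apply: open_nbhs_nbhs; split=> //; exact: discrete_open.
  by apply: filterS2 ip IH => q /= -> ->.
Qed.

(** Finite lists of coordinates give the basic neighbourhoods of the cube, so this is membership in
    the closure of the range of [ev]. Such a [p] amounts to an ultrafilter on the algebra generated
    by the sets of those [t] with [ev t i]. *)
Definition approximable p :=
  forall L, exists t, map p L = map (ev t) L.

Definition bclosure : set cube := [set p | approximable p].

Lemma bclosure_closed : closed bclosure.
Proof.
move=> p clp L.
have /clp[q [Kq /= qp]] : nbhs (p : cube) [set q : cube | map q L = map p L].
  by apply/nbhs_cube; exists L.
by have [t qt] := Kq L; exists t; rewrite -qp.
Qed.

Lemma bclosure_compact : compact [set: set_type bclosure].
Proof.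
apply/compact_set_type/(subclosed_compact bclosure_closed (B := setT)) => //.
have := @tychonoff I (fun=> bool) (fun=> setT) (fun=> bool_compact).
by congr (compact _); apply/seteqP; split.
Qed.

Lemma bclosure_hausdorff : hausdorff_space (set_type bclosure).
Proof.
apply: hausdorff_set_type.
exact: (@hausdorff_product I (fun=> bool) (fun=> discrete_hausdorff)).
Qed.

Lemma nbhs_bclosure (p : set_type bclosure) (U : set (set_type bclosure)) :
  nbhs p U <->
  exists L, forall q : set_type bclosure, map (val q) L = map (val p) L -> U q.
Proof.
split=> [/nbhs_set_type[V /nbhs_cube[L LV] VU]|[L LU]].
  by exists L => q /LV; exact: VU.
apply/nbhs_set_type; exists [set q : cube | map q L = map (val p) L].
  by apply/nbhs_cube; exists L.
by move=> q; exact: LU.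
Qed.

End BooleanClosure.

(** * Nodes, branches and lexicographic cuts of the binary tree *)

Section Tree.
Implicit Types (s t : seq bool) (x y z : nat -> bool) (n k : nat).

(** The bit [c x] of the overview. Odd places are left free for the diagonal argument in
    [evens1_avoid]. *)
Definition evens1 x : bool := `[< exists N, forall n, (N <= n)%N -> x n.*2 >].

(* Equals [size t] when [t] is an initial segment of [x]. *)
Definition fdiff x t := find (fun i => nth false t i != x i) (iota 0 (size t)).

(** Membership of [t] in [A_x]: where [t] first leaves [x], it lies below [x] exactly when [x] has a
    1 there. *)
Definition lexset x t : bool :=
  if (fdiff x t < size t)%N then x (fdiff x t) else evens1 x.

Definition first_diff x t k :=
  [/\ (k < size t)%N, forall i, (i < k)%N -> nth false t i = x i
    & nth false t k != x k].

Lemma lexset_diff x t k : first_diff x t k -> lexset x t = x k.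
Proof.
move=> [kt tx tk].
suff fk : fdiff x t = k by rewrite /lexset fk kt.
have hasd : has (fun i => nth false t i != x i) (iota 0 (size t)).
  by apply/hasP; exists k; rewrite ?mem_iota.
have := nth_find 0 hasd; rewrite -/(fdiff x t).
have := hasd; rewrite has_find size_iota -/(fdiff x t) => ft.
rewrite nth_iota// add0n => fd.
case: (ltngtP (fdiff x t) k) => // [fk|kf].
  by rewrite tx// eqxx in fd.
by have := before_find 0 kf; rewrite nth_iota// add0n tk.
Qed.

Lemma first_diffP x t : t <> mkseq x (size t) -> exists k, first_diff x t k.
Proof.
move=> tx.
have ex : exists k, (k < size t)%N && (nth false t k != x k).
  apply: contrapT => nex; apply: tx; apply: (@eq_from_nth _ false).
    by rewrite size_mkseq.
  move=> i it; rewrite nth_mkseq//; apply/eqP; apply: contrapT => /negP ti.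
  by apply: nex; exists i; rewrite it.
case: (ex_minnP ex) => k /andP[kt tk] mink; exists k; split=> // i ik.
apply/eqP; apply: contrapT => /negP ti.
by have := mink i; rewrite (ltn_trans ik kt) ti => /(_ isT); rewrite leqNgt ik.
Qed.

Lemma lexset_mkseq x n : lexset x (mkseq x n) = evens1 x.
Proof.
rewrite /lexset /fdiff size_mkseq ifF//; apply/negbTE.
rewrite -leqNgt -[X in (X <= _)%N](size_iota 0 n) leqNgt -has_find.
by apply/hasPn => i; rewrite mem_iota add0n => /= i_n; rewrite nth_mkseq// eqxx.
Qed.

Lemma first_diff_prefix x s t k :
  prefix s t -> first_diff x s k -> first_diff x t k.
Proof.
move=> /prefixP[u ->] [ks sx sk]; split=> [|i ik|].
- by rewrite size_cat (leq_trans ks)// leq_addr.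
- by rewrite nth_cat (ltn_trans ik ks) sx.
- by rewrite nth_cat ks.
Qed.

(** Once a node has left [x], all its extensions leave at the same place, so [A_x] contains or
    misses the whole cone. *)
Lemma lexset_cone x s t :
  prefix s t -> s <> mkseq x (size s) -> lexset x t = lexset x s.
Proof.
move=> st /first_diffP[k sk]; rewrite (lexset_diff sk).
exact/lexset_diff/first_diff_prefix/sk.
Qed.

(** The place where [s] leaves [x] is among the bits shared with [y]. Hence [A_x] and [A_y] can
    differ, up to finitely many nodes, only inside a common cone. *)
Lemma eq_lexset x y s : mkseq x (size s) = mkseq y (size s) ->
  s <> mkseq x (size s) -> lexset x s = lexset y s.
Proof.
move=> xy /first_diffP[k [ks sx sk]].
have xyE i : (i < size s)%N -> x i = y i.
  by move=> i_s; rewrite -(nth_mkseq false x i_s) xy nth_mkseq.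
rewrite (@lexset_diff x s k)// (@lexset_diff y s k) ?xyE//.
split=> // [i ik|]; last by rewrite -xyE.
by rewrite -xyE ?sx// (ltn_trans ik).
Qed.

Lemma lexset_off z j : lexset z (rcons (mkseq z j) (~~ z j)) = z j.
Proof.
apply: lexset_diff; split=> [|i ij|].
- by rewrite size_rcons size_mkseq.
- by rewrite nth_rcons size_mkseq ij nth_mkseq.
- by rewrite nth_rcons size_mkseq ltnn eqxx; case: (z j).
Qed.

Lemma prefix_mkseq z n k : (n <= k)%N -> prefix (mkseq z n) (mkseq z k).
Proof.
move=> nk; apply/prefixP; exists (mkseq (fun i => z (n + i)%N) (k - n)).
have iE : iota n (k - n) = map (addn n) (iota 0 (k - n)) by rewrite -iotaDl addn0.
by rewrite -{1}(subnKC nk) /mkseq iotaD map_cat add0n iE -map_comp.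
Qed.

Lemma prefix_mkseqE z s n : prefix s (mkseq z n) -> s = mkseq z (size s).
Proof.
move=> /prefixP[u su].
have sn : (size s <= n)%N by rewrite -(size_mkseq z n) su size_cat leq_addr.
apply: (@eq_from_nth _ false) => [|i i_s]; first by rewrite size_mkseq.
by rewrite nth_mkseq// -(nth_mkseq false z (leq_trans i_s sn)) su nth_cat i_s.
Qed.

(** * The compact space and its ideal points *)

Definition coord : choiceType := (seq bool + seq bool + (nat -> bool))%type.
Definition pt s : coord := inl (inl s).
Definition cone s : coord := inl (inr s).
Definition cut x : coord := inr x.

Definition ev t (i : coord) : bool :=
  match i with
  | inl (inl s) => t == s
  | inl (inr s) => prefix s t
  | inr x => lexset x t
  end.

Definition gspace := set_type (bclosure ev).
Implicit Types p q : gspace.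

Definition coordval p : coord -> bool := val p.
Arguments coordval : simpl never.
Coercion coordval : gspace >-> Funclass.

Lemma approxP p (L : seq coord) : exists t, map p L = map (ev t) L.
Proof. exact: set_valP p L. Qed.

Lemma ev_approximable t : bclosure ev (ev t).
Proof. by move=> L; exists t. Qed.

Definition emb t : gspace := SigSub (mem_set (ev_approximable t)).

Lemma embE t : emb t = ev t :> (coord -> bool).
Proof. by []. Qed.

Lemma gspace_ext p q : (forall i, p i = q i) -> p = q.
Proof. by move=> pq; apply/val_inj/funext. Qed.

(** Singletons are atoms: a node approximating [p] at [pt s] and at any further coordinate must be
    [s]. *)
Lemma pt_emb p s : p (pt s) -> p = emb s.
Proof.
move=> ps; apply: gspace_ext => i.
by have [t [+ ->]] := approxP p [:: pt s; i]; rewrite ps => /esym/eqP ->.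
Qed.

Lemma emb_inj : injective emb.
Proof.
move=> s t st; have : emb s (pt t) by rewrite st embE /= eqxx.
by rewrite embE /= => /eqP.
Qed.

Definition ideal p := forall s, p (pt s) = false.

Lemma idealP p : ideal p <-> ~ range emb p.
Proof.
split=> [ip [s _ sp]|np s]; first by have := ip s; rewrite -sp embE /= eqxx.
by apply/negP => /pt_emb ps; apply: np; exists s.
Qed.

(** A cone is its root together with two child cones. An ideal point omits the root, so it selects a
    child, and iterating this choice traces a branch. *)
Lemma branchP p : ideal p -> exists z, forall n, p (cone (mkseq z n)).
Proof.
move=> ip.
pose st := fix st n := if n is m.+1 then
  rcons (st m) (p (cone (rcons (st m) true))) else [::].
pose z n := p (cone (rcons (st n) true)).
have stE n : st n = mkseq z n.
  by elim: n => //= n IH; rewrite mkseqS -IH.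
exists z => n; rewrite -stE; elim: n => [|n IH].
  by have [t []] := approxP p [:: cone [::]] => ->; rewrite prefix0s.
have [t []] := approxP p [:: cone (st n); pt (st n);
  cone (rcons (st n) true); cone (rcons (st n) false)].
(* The approximating node extends [st n], and not trivially because [p] omits that singleton; its
   next bit [b] names the child. *)
rewrite IH ip /= -!/(cone _) => /esym/prefixP[[|b u] ->].
  by rewrite cats0 eqxx.
case E : (p (cone (rcons (st n) true))) => _; first by rewrite E.
rewrite -cat_rcons; case: b; first by rewrite prefix_prefix.
by move=> _ ->; rewrite prefix_prefix.
Qed.

(** Off the branch [x] the cone alone decides the cut, so for a point over [z] only the cut at [z]
    carries extra information. *)
Lemma cut_cone p s x :
  p (cone s) -> s <> mkseq x (size s) -> p (cut x) = lexset x s.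
Proof.
move=> ps sx; have [t []] := approxP p [:: cone s; cut x].
by rewrite ps => /esym/= st ->; exact: lexset_cone.
Qed.

Lemma cone_prefix p s t : prefix s t -> p (cone t) -> p (cone s).
Proof.
move=> st pt; have [u []] := approxP p [:: cone s; cone t].
by rewrite pt => -> /= /esym; exact: prefix_trans.
Qed.

Lemma cone_inj p s t : size s = size t ->
  p (cone s) -> p (cone t) -> s = t.
Proof.
move=> st ps pt; have [u []] := approxP p [:: cone s; cone t].
rewrite ps pt /= => /esym + /esym.
by rewrite !prefixE st => /eqP <- /eqP.
Qed.

Lemma neq_mkseq x z : x <> z -> exists n, mkseq z n <> mkseq x n.
Proof.
move=> xz; apply: contrapT => nex; apply: xz; apply/funext => i.
rewrite -(nth_mkseq false x (ltnSn i)) -(nth_mkseq false z (ltnSn i)).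
by congr nth; apply: contrapT => xz; apply: nex; exists i.+1 => /esym.
Qed.

(** A neighbourhood involves finitely many coordinates, and each one except the cut at [z] is
    decided by a deep enough cone along [z]. *)
Lemma nbhs_ideal p z (U : set gspace) :
  ideal p -> (forall n, p (cone (mkseq z n))) ->
  nbhs p U ->
  exists n, forall q,
    q (cone (mkseq z n)) -> q (cut z) = p (cut z) -> U q.
Proof.
move=> ip pz /nbhs_bclosure[L LU].
suff [n qn] : exists n, forall q, q (cone (mkseq z n)) ->
    q (cut z) = p (cut z) -> map q L = map p L.
  by exists n => q qz qp; apply/LU/qn.
elim: L {LU} => [|i L [n IH]]; first by exists 0.
suff [m im] : exists m, forall q, q (cone (mkseq z m)) ->
    q (cut z) = p (cut z) -> q i = p i.
  exists (maxn m n) => q qz qp /=; congr cons.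
    by apply: im => //; apply: cone_prefix qz; rewrite prefix_mkseq// leq_maxl.
  by apply: IH => //; apply: cone_prefix qz; rewrite prefix_mkseq// leq_maxr.
case: i => [[s|s]|x].
(* One level beyond [s], so that the cone no longer contains [s] itself. *)
- exists (size s).+1 => q qz _; rewrite -/(pt s) ip.
  apply/negbTE/negP => /pt_emb qs.
  have /size_prefix : prefix (mkseq z (size s).+1) s by move: qz; rewrite qs.
  by rewrite size_mkseq ltnn.
- exists (size s) => q qz _; rewrite -/(cone s).
  have [<-//|sz] := pselect (mkseq z (size s) = s).
    by rewrite qz pz.
  rewrite [LHS](_ : _ = false); last first.
    by apply/negP => qs; apply: sz; apply: cone_inj qz qs; rewrite size_mkseq.
  apply/esym/negP => ps; apply: sz.
  by apply: cone_inj (pz (size s)) ps; rewrite size_mkseq.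
- have [->|/neq_mkseq[n0 xz]] := pselect (x = z); first by exists 0.
  exists n0 => q qz _; rewrite -/(cut x).
  by rewrite (cut_cone qz) ?(cut_cone (pz n0))// size_mkseq.
Qed.

Lemma ev_mkseq_stable z i : exists N b, forall n, (N <= n)%N -> ev (mkseq z n) i = b.
Proof.
case: i => [[s|s]|x] /=.
- exists (size s).+1, false => n sn; apply/negbTE/eqP => /(congr1 size).
  by rewrite size_mkseq => ns; rewrite ns ltnn in sn.
- exists (size s), (s == mkseq z (size s)) => n sn.
  apply/idP/eqP => [/prefix_mkseqE//|->]; rewrite prefix_mkseq//.
- have [->|/neq_mkseq[N xz]] := pselect (x = z).
    by exists 0, (evens1 z) => n _; rewrite lexset_mkseq.
  exists N, (lexset x (mkseq z N)) => n Nn; apply: lexset_cone.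
    exact: prefix_mkseq.
  by rewrite size_mkseq.
Qed.

(** Every coordinate stabilises along a branch, and the limit is ideal because the lengths grow.
    These limits supply remainder points in all cones, and later the points where the projected
    function must vanish. *)
Lemma emb_cvg z : exists2 p, ideal p & emb (mkseq z n) @[n --> \oo] --> p.
Proof.
have [v vP] : exists v : coord -> bool, forall i, exists N, forall n,
    (N <= n)%N -> ev (mkseq z n) i = v i.
  have /choice[N /choice[v vP]] := ev_mkseq_stable z.
  by exists v => i; exists (N i); exact: vP.
have vL (L : seq coord) : exists N, forall n, (N <= n)%N ->
    map (ev (mkseq z n)) L = map v L.
  elim: L => [|i L [N IH]]; first by exists 0.
  have [M iM] := vP i; exists (maxn M N) => n; rewrite geq_max => /andP[Mn Nn] /=.
  by rewrite iM// IH.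
have vK : bclosure ev v.
  by move=> L; have [N /(_ N (leqnn N)) NL] := vL L; exists (mkseq z N).
exists (SigSub (mem_set vK)).
- move=> s; have [N NP] := vP (pt s).
  rewrite -[LHS]/(v (pt s)) -(NP (maxn N (size s).+1)) ?leq_maxl//=.
  apply/negbTE/eqP => /(congr1 size); rewrite size_mkseq => sE.
  by have := leq_maxr N (size s).+1; rewrite sE ltnn.
- move=> U /nbhs_bclosure[L LU]; have [N NL] := vL L.
  by exists N => // n /= Nn; apply: LU; exact: NL.
Qed.

End Tree.

(** * The compactification of the naturals: first countability and separable remainder *)

Section Compactification.
Implicit Types (s t : seq bool) (x y z : nat -> bool) (p q : gspace).

Lemma nbhs_coord p (i : coord) : nbhs p [set q : gspace | q i = p i].
Proof. by apply/nbhs_bclosure; exists [:: i] => q []. Qed.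

Lemma open_pt t : open [set p : gspace | p (pt t)].
Proof.
rewrite openE => p tp; apply: filterS (nbhs_coord p (pt t)) => q /= ->.
exact: tp.
Qed.

Lemma range_emb_dense : dense (range emb).
Proof.
move=> O [p Op] oO.
have /nbhs_bclosure[L LO] : nbhs p O by apply: open_nbhs_nbhs.
have [t tp] := approxP p L.
by exists (emb t); split; [apply/LO/esym|exists t].
Qed.

(* The parity condition in [evens1] gives an eventually constant branch the
   value of its tail, so that no point of the remainder is isolated. *)
Lemma off_branch p z k : (forall n, p (cone (mkseq z n))) ->
  exists t, [/\ prefix (mkseq z k) t, t <> mkseq z (size t)
    & lexset z t = p (cut z)].
Proof.
move=> pz; have [[j [kj zj]]|nz] :=
    pselect (exists j, (k <= j)%N /\ z j = p (cut z)).
  exists (rcons (mkseq z j) (~~ z j)); split; last by rewrite lexset_off.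
    by rewrite -cats1 (prefix_trans (prefix_mkseq z kj))// prefix_prefix.
  move=> /(congr1 (nth false ^~ j)).
  rewrite nth_rcons size_rcons !size_mkseq ltnn eqxx nth_mkseq//.
  by case: (z j).
(* Now [z] is constant from [k] on, with the bit opposite to [p (cut z)]. Then [evens1 z] is that
   bit too, so the approximating node cannot lie on [z]. *)
have [t []] := approxP p [:: cone (mkseq z k); cut z].
rewrite pz => /esym kt tp.
have [tz|?] := pselect (t = mkseq z (size t)); last by exists t; split.
move: tp nz => ->; rewrite tz lexset_mkseq => nz; exfalso.
have [zE|/negbTE zE] := boolP (evens1 z).
- have [N NP] := asboolP _ zE; apply: nz; exists (maxn N k).*2.
  by rewrite zE NP ?leq_maxl// -addnn (leq_trans (leq_maxr N k))// leq_addr.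
- suff : evens1 z by rewrite zE.
  apply/asboolP; exists k => n kn.
  apply: contrapT => /negP zn; apply: nz; exists n.*2.
  by rewrite -addnn (leq_trans kn) ?leq_addr// addnn (negbTE zn) zE.
Qed.

Lemma tree_bij : exists b : nat -> seq bool,
  injective b /\ forall t, exists n, b n = t.
Proof.
have inf : infinite_set [set: seq bool].
  have nseqI : {in [set: nat] &, injective (nseq^~ true)}.
    by move=> m n _ _ /(congr1 size); rewrite !size_nseq.
  apply: (@sub_infinite_set _ (range (nseq^~ true))) => //.
  by apply/infiniteP; have := inj_card_eq nseqI; rewrite card_eq_le => /andP[].
have /card_set_bijP[g [_ ginj gsurj]] := eq_card_nat (countableP _) inf.
have /choice[b bK] : forall n, exists t, g t = n.
  by move=> n; have [t _ <-] := gsurj n I; exists t.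
exists b; split=> [m n mn|t]; first by rewrite -(bK m) mn bK.
by exists (g t); apply: ginj; rewrite ?inE.
Qed.

Variables (b : nat -> seq bool) (b_inj : injective b).
Hypothesis b_surj : forall t, exists n, b n = t.

Lemma range_emb_b : range (emb \o b) = range emb.
Proof.
apply/seteqP; split=> _ [t _ <-]; first by exists (b t).
by have [n <-] := b_surj t; exists n.
Qed.

Lemma nat_initial : @open nat = @open (initial_topology (emb \o b)).
Proof.
apply/seteqP; split=> A _; last exact: discrete_open.
exists (\bigcup_(n in A) [set p : gspace | p (pt (b n))]).
  by apply: bigcup_open => n _; exact: open_pt.
apply/seteqP; split=> n /=; last by exists n => //=; rewrite /= embE /=.
by move=> [m Am]; rewrite /= embE /= => /eqP/b_inj ->.
Qed.

Lemma range_emb_b_dense : dense (range (emb \o b)).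
Proof. by rewrite range_emb_b; exact: range_emb_dense. Qed.

Definition tree_compactification : compactification nat :=
  Compactification (@bclosure_compact _ _ ev) (@bclosure_hausdorff _ _ ev)
    (inj_comp emb_inj b_inj) nat_initial range_emb_b_dense.

Lemma remainderE p : remainder tree_compactification p <-> ideal p.
Proof. by rewrite idealP -range_emb_b; split. Qed.

Lemma tree_first_countable : first_countable tree_compactification.
Proof.
move=> p'; pose p : gspace := p'; rewrite -[p']/p.
have [ip|/idealP/contrapT[s _ sp]] := pselect (ideal p).
- have [z pz] := branchP ip.
  pose W n := [set q : gspace | q (cone (mkseq z n)) /\ q (cut z) = p (cut z)].
  exists (range W); first exact: card_le_trans (card_image_le _ _) (countableP _).
  split=> [_ [n _ <-]|U /(nbhs_ideal ip pz)[n nU]].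
    apply: filterS2 (nbhs_coord p (cone (mkseq z n))) (nbhs_coord p (cut z)).
    by move=> q /= qz qp; split=> //; rewrite qz.
  by exists (W n) => [|q [qz qp]]; [exists n|exact: nU].
- exists [set [set q : gspace | q (pt s)]]; first exact: countable1.
  have ps : p (pt s) by rewrite -sp embE /=.
  split=> [_ ->|U Up].
    by apply: open_nbhs_nbhs; split=> //; exact: open_pt.
  exists [set q : gspace | q (pt s)] => // q /pt_emb ->; rewrite sp.
  exact: nbhs_singleton.
Qed.

(** One remainder point per cone suffices: by [off_branch], every basic neighbourhood of an ideal
    point contains an entire cone, taken off its branch on the correct side of the cut. *)
Lemma tree_remainder_separable :
  separable (set_type (remainder tree_compactification)).
Proof.
have /choice[d dP] : forall t,
    exists p : set_type (remainder tree_compactification),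
      (val p : gspace) (cone t).
  (* The branch through [t] that continues with zeros. *)
  move=> t; have [p ip tp] := emb_cvg (nth false t).
  have rp : p \in remainder tree_compactification by exact/mem_set/remainderE.
  exists (SigSub rp) => /=.
  have [N _ /(_ _ (leq_maxl N (size t)))/= <-] := tp _ (nbhs_coord p (cone t)).
  rewrite embE /= -[X in prefix X](mkseq_nth false t).
  by apply: prefix_mkseq; exact: leq_maxr.
exists (range d); first exact: card_le_trans (card_image_le _ _) (countableP _).
move=> O [p Op] oO.
have /nbhs_set_type[V Vp VO] : nbhs p O by apply: open_nbhs_nbhs.
have ip : ideal (val p) by apply/remainderE; exact: set_valP.
have [z pz] := branchP ip.
have [n nV] := nbhs_ideal ip pz Vp.
have [t [zt tz tp]] := off_branch n pz.
exists (d t); split; last by exists t.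
apply/VO/nV; first exact: cone_prefix zt (dP t).
by rewrite (cut_cone (dP t) tz).
Qed.

End Compactification.

(** * Category argument on branches *)

Section Fusion.
Local Open Scope ring_scope.
Variables (R : realType) (phi : seq bool -> (nat -> bool) -> R).
Implicit Types (x y z w : nat -> bool) (n m k : nat).

(** Off this set [g] stays within 1/4 of [g x] on a neighbourhood of [x] in Cantor space, which is
    the weak continuity that [fusion_step] needs. *)
Definition jump (g : (nat -> bool) -> R) : set (nat -> bool) :=
  [set x | forall m, exists y, mkseq y m = mkseq x m /\ 4^-1 < `|g y - g x|].

Lemma mkseq_le x y n m : (n <= m)%N -> mkseq x m = mkseq y m ->
  mkseq x n = mkseq y n.
Proof.
move=> nm xy; apply: (@eq_from_nth _ false); rewrite !size_mkseq// => i i_n.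
rewrite !nth_mkseq//; move/(congr1 (nth false ^~ i)): xy.
by rewrite !nth_mkseq// (leq_trans i_n).
Qed.

(** Beyond [n], even places are filled with [c] and odd places diagonalise against an enumeration of
    [D]. *)
Lemma evens1_avoid (D : set (nat -> bool)) x n (c : bool) : countable D ->
  exists y, [/\ mkseq y n = mkseq x n, evens1 y = c & ~ D y].
Proof.
move=> /countable_injP[f fD].
(* Shifting the code by [n] puts the diagonal place [(f u + n).*2.+1] beyond the prescribed bits. *)
have /choice[d dP] : forall k, exists y, forall u, D u -> (f u + n)%N = k -> u = y.
  move=> k; have [[y [Dy fy]]|ny] := pselect (exists y, D y /\ (f y + n)%N = k).
    exists y => u Du fu; apply: fD; rewrite ?inE//.
    by apply/eqP; rewrite -(eqn_add2r n) fu fy.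
  by exists x => u Du fu; exfalso; apply: ny; exists u.
pose y i := if (i < n)%N then x i else if odd i then ~~ d i./2 i else c.
exists y; split.
- apply: (@eq_from_nth _ false); rewrite !size_mkseq// => i i_n.
  by rewrite !nth_mkseq// /y i_n.
- have ye i : (n <= i)%N -> y i.*2 = c.
    move=> ni; rewrite /y odd_double ltnNge (leq_trans ni)//.
    by rewrite -addnn leq_addr.
  case: c @y ye => y ye; first by apply/asboolP; exists n.
  apply/negbTE/negP => /asboolP[N /(_ _ (leq_maxl N n))].
  by rewrite ye ?leq_maxr.
- move=> Dy; have := dP _ _ Dy erefl.
  move=> /(congr1 (fun u => u (f y + n).*2.+1)).
  rewrite {1}/y ltnNge; have -> : (n <= (f y + n).*2.+1)%N.
    by rewrite leqW// -addnn -addnA (leq_trans (leq_addl (f y) n))// leq_add2l leq_addr.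
  rewrite /= odd_double/= uphalf_double.
  by case: (d _ _).
Qed.

Hypothesis phi_jump : forall s, countable (jump (phi s)).
Hypothesis phi_cvg :
  forall x, phi (mkseq x n) x @[n --> \oo] --> ((evens1 x)%:R : R).

(** Choose [y] with bit [c] outside all jump sets. Convergence along [y] costs 1/4 at some level
    [k], and passing from [y] to nearby [w] costs another 1/4. *)
Lemma fusion_step (c : bool) x n : exists y m,
  [/\ (n < m)%N, mkseq y n = mkseq x n &
    forall w, mkseq w m = mkseq y m ->
      exists2 k, (n <= k)%N & `|phi (mkseq w k) w - c%:R| < 2^-1].
Proof.
have [|y [yx yc nDy]] :=
    @evens1_avoid (\bigcup_(s in [set: seq bool]) jump (phi s)) x n c.
  by apply: bigcup_countable => //; exact: countableP.
have /cvgrPdist_lt/(_ 4^-1)[|N _ Ny] := @phi_cvg y; first by rewrite invr_gt0.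
pose k := maxn N n.
have yk : `|phi (mkseq y k) y - c%:R| < 4^-1.
  by rewrite distrC -yc; apply: Ny => /=; exact: leq_maxl.
have [m ym] : exists m, forall w, mkseq w m = mkseq y m ->
    `|phi (mkseq y k) w - phi (mkseq y k) y| <= 4^-1.
  apply: contrapT => nm; apply: nDy; exists (mkseq y k) => // m.
  apply: contrapT => nw; apply: nm; exists m => w wy.
  by rewrite leNgt; apply/negP => lt; apply: nw; exists w.
(* Length [k] makes [w] and [y] share the node of level [k]; [n.+1] forces strict growth. *)
exists y, (maxn m (maxn k n.+1)); split=> // [|w wy].
  by rewrite !leq_max ltnSn !orbT.
exists k; first exact: leq_maxr.
rewrite (mkseq_le _ wy); last by rewrite maxnCA leq_maxl.
rewrite (_ : 2^-1 = 4^-1 + 4^-1 :> R); last by lra.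
apply: le_lt_trans (ler_distD (phi (mkseq y k) y) _ _) _.
by apply: ler_ltD => //; apply/ym/(mkseq_le _ wy); rewrite leq_maxl.
Qed.

(* Each step fixes a longer initial segment of [w] along which [phi] comes close
   to both [0] and [1]. *)
Lemma fusion : False.
Proof.
pose near w n (c : bool) :=
  exists2 k, (n <= k)%N & `|phi (mkseq w k) w - c%:R| < 2^-1.
have step (u : (nat -> bool) * nat) : {v : (nat -> bool) * nat |
    [/\ (u.2 < v.2)%N, mkseq v.1 u.2 = mkseq u.1 u.2 &
      forall w, mkseq w v.2 = mkseq v.1 v.2 -> forall c, near w u.2 c]}.
  apply: cid; case: u => x n /=.
  have [y [m [nm yx yw]]] := fusion_step false x n.
  have [z [l [ml zy zw]]] := fusion_step true y m.
  exists (z, l); split=> [||w wz [|]] /=.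
  - exact: ltn_trans ml.
  - by rewrite (mkseq_le (ltnW nm) zy).
  - by have [k mk] := zw w wz; exists k => //; rewrite (leq_trans (ltnW nm)).
  - by apply: yw; rewrite -zy; apply: mkseq_le wz; exact: ltnW.
have [u [_ uS]] := dependent_choice step (fun=> false, 0)%N.
have u_lt i : (i <= (u i).2)%N.
  by elim: i => // i IH; have [lt _ _] := uS i; exact: leq_ltn_trans lt.
have u_mono i j : (i <= j)%N ->
    mkseq (u j).1 (u i).2 = mkseq (u i).1 (u i).2 /\ ((u i).2 <= (u j).2)%N.
  move=> /subnKC <-; elim: (j - i)%N => [|d [IH le]]; first by rewrite addn0.
  have [lt e _] := uS (i + d)%N; rewrite addnS; split; last exact: leq_trans (ltnW lt).
  by rewrite -IH (mkseq_le le e).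
(* Stage [j.+1] fixes at least [j.+1] bits, so its bit [j] is final. *)
pose w j := (u j.+1).1 j.
have wu i : mkseq w (u i).2 = mkseq (u i).1 (u i).2.
  apply: (@eq_from_nth _ false); rewrite !size_mkseq// => j ji.
  rewrite !nth_mkseq// /w; have [ij|/ltnW ij] := leqP i j.+1.
    have [/(congr1 (nth false ^~ j)) + _] := u_mono _ _ ij.
    by rewrite !nth_mkseq.
  have [/(congr1 (nth false ^~ j)) + _] := u_mono _ _ ij.
  by rewrite !nth_mkseq// ?u_lt// => ->.
have /cvgrPdist_lt/(_ 2^-1)[|N _ Nw] := @phi_cvg w; first by rewrite invr_gt0.
(* Beyond [N] the sequence comes within 1/2 of the wrong bit as well as of its limit, yet 0 and 1
   are at distance 1. *)
have [_ _ /(_ w (wu N.+1) (~~ evens1 w))[k Nk kw]] := uS N.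
have {}Nk : (N <= k)%N by exact: leq_trans (u_lt N) Nk.
have /= := Nw k Nk; move: kw.
by case: (evens1 w) => /=; rewrite !ltr_norml => /andP[? ?] /andP[? ?]; lra.
Qed.

End Fusion.

(** * Bounded functionals that vanish on the copy of [c_0] *)

Section NotSmooth.
Local Open Scope ring_scope.
Variables (R : realType) (b : nat -> seq bool) (b_inj : injective b).
Hypothesis b_surj : forall t, exists n, b n = t.
Local Notation gw := (tree_compactification b_inj b_surj).
Local Notation V := (Cspace R (@comp_compact _ gw)).
Implicit Types (x y z : nat -> bool) (p q : gspace) (g h : V).

Definition Ceval p g : R := (g : continuousType gw R) p.
Arguments Ceval : simpl never.

Lemma CevalD p g h : Ceval p (g + h) = Ceval p g + Ceval p h.
Proof. by []. Qed.

Lemma CevalB p g h : Ceval p (g - h) = Ceval p g - Ceval p h.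
Proof. by []. Qed.

Lemma CevalZ p (a : R) g : Ceval p (a *: g) = a * Ceval p g.
Proof. by []. Qed.

Lemma Ceval_sum p (J : Type) (r : seq J) (F : J -> V) :
  Ceval p (\sum_(i <- r) F i) = \sum_(i <- r) Ceval p (F i).
Proof. exact: (big_morph (Ceval p) (CevalD p)). Qed.

Lemma loc_const_continuous (f : gspace -> R) :
  (forall p, \forall q \near p, f q = f p) -> continuous f.
Proof. by move=> fP p; exact: (@cvg_near_cst _ _ (f p) f (nbhs p) _ (fP p)). Qed.

Definition cut_fun x p : R := (p (cut x))%:R.

Lemma cut_fun_continuous x : continuous (cut_fun x).
Proof.
apply: loc_const_continuous => p; apply: filterS (nbhs_coord p (cut x)) => q /=.
by rewrite /cut_fun => ->.
Qed.

Definition cutC x : V := mkcts (@cut_fun_continuous x) : continuousType gw R.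

(* Cutting off to a cone makes these differences pairwise disjointly supported,
   at the cost of an element of [c_0]. *)
Definition diff_fun x y (m : nat) p : R :=
  if p (cone (mkseq x m)) then cut_fun y p - cut_fun x p else 0.

Lemma diff_fun_continuous x y m : continuous (diff_fun x y m).
Proof.
apply: loc_const_continuous => p.
apply: filterS3 (nbhs_coord p (cut x)) (nbhs_coord p (cut y))
  (nbhs_coord p (cone (mkseq x m))) => q /=.
by rewrite /diff_fun /cut_fun => -> -> ->.
Qed.

Definition diffC x y m : V :=
  mkcts (@diff_fun_continuous x y m) : continuousType gw R.

(** A remainder point outside the cone has a branch that leaves [x] and [y] at the same place before
    level [m], so both cuts take the same value there. *)
Lemma diffC_c0 x y m : mkseq y m = mkseq x m ->
  c0_copy R gw (diffC x y m - (cutC y - cutC x)).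
Proof.
move=> yx p /remainderE ip; rewrite -/(Ceval p _) !CevalB.
rewrite [Ceval p (diffC _ _ _)]/(diff_fun x y m p) /diff_fun.
rewrite ![Ceval p (cutC _)]/(cut_fun _ p).
case: ifPn => [_|xp]; first by rewrite subrr.
have [z pz] := branchP ip.
have zx : mkseq z m <> mkseq x (size (mkseq z m)).
  by rewrite size_mkseq => zx; move: xp; rewrite -zx pz.
rewrite /cut_fun (cut_cone (pz m) zx) (@cut_cone p (mkseq z m) y)//.
  by rewrite (@eq_lexset x y)// ?subrr ?subr0// size_mkseq.
by rewrite size_mkseq yx -[X in mkseq x X](size_mkseq z m).
Qed.

Variables (nu : V -> R) (B : R).
Hypothesis nuB : forall g h, nu (g - h) = nu g - nu h.
Hypothesis nuD : forall g h, nu (g + h) = nu g + nu h.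
Hypothesis nuZ : forall a g, nu (a *: g) = a * nu g.
Hypothesis nu_c0 : forall g, c0_copy R gw g -> nu g = 0.
Hypothesis nu_le : forall g, (forall p, `|Ceval p g| <= 1) -> `|nu g| <= B.

Lemma mkseq_separate (s : seq (nat -> bool)) : exists m,
  forall x y, x \in s -> y \in s -> mkseq x m = mkseq y m -> x = y.
Proof.
have /choice[N NP] : forall u : (nat -> bool) * (nat -> bool),
    exists n, mkseq u.1 n = mkseq u.2 n -> u.1 = u.2.
  move=> [x y] /=; have [->|/neq_mkseq[n yx]] := pselect (x = y); first by exists 0.
  by exists n => xy; rewrite xy in yx.
exists (\max_(x <- s) \max_(y <- s) N (x, y)) => x y xs ys xy.
apply: (NP (x, y)) => /=; apply: mkseq_le xy.
apply: leq_trans (leq_bigmax_seq _ xs isT) => /=.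
exact: (@leq_bigmax_seq _ _ _ (fun y => N (x, y))).
Qed.

(** Modulo [c_0] the differences live on disjoint cones. Adding them with the signs of their
    [nu]-values gives a function bounded by 1 whose image under [nu] is the sum of absolute
    values. *)
Lemma jump_sum_le (s : seq (nat -> bool)) (y : (nat -> bool) -> nat -> bool)
    (m : nat) :
  uniq s -> {in s &, injective (fun x : nat -> bool => mkseq x m)} ->
  (forall x, x \in s -> mkseq (y x) m = mkseq x m) ->
  \sum_(x <- s) `|nu (cutC (y x)) - nu (cutC x)| <= B.
Proof.
move=> us sm ym; pose h x := diffC x (y x) m.
have nuh x : x \in s -> nu (h x) = nu (cutC (y x)) - nu (cutC x).
  move=> /ym/diffC_c0/nu_c0; rewrite nuB => /eqP; rewrite subr_eq0 => /eqP ->.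
  exact: nuB.
pose G : V := \sum_(x <- s) Num.sg (nu (h x)) *: h x.
have -> : \sum_(x <- s) `|nu (cutC (y x)) - nu (cutC x)| = nu G.
  have nu0 : nu 0 = 0 by rewrite -(subrr (0 : V)) nuB subrr.
  rewrite /G (big_morph nu nuD nu0) big_seq [RHS]big_seq.
  by apply: eq_bigr => x xs; rewrite nuZ -normrEsg nuh.
apply: le_trans (ler_norm _) (nu_le _) => p.
rewrite /G Ceval_sum.
have h0 x : ~~ p (cone (mkseq x m)) -> Ceval p (Num.sg (nu (h x)) *: h x) = 0.
  move=> px; rewrite CevalZ [Ceval _ _]/(diff_fun x (y x) m p) /diff_fun.
  by rewrite (negbTE px) mulr0.
have [/hasP[x xs px]|/hasPn sp] := boolP (has (fun x => p (cone (mkseq x m))) s).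
- rewrite (bigD1_seq x)//= big1_seq ?addr0; last first.
    move=> u /andP[ux us'].
    apply: h0; apply/negP => pu; move/eqP: ux; apply; apply: sm => //.
    by apply: (cone_inj _ pu px); rewrite !size_mkseq.
  rewrite CevalZ [Ceval _ _]/(diff_fun x (y x) m p) /diff_fun px normrM.
  apply: mulr_ile1 => //; first by rewrite normr_sg lern1 leq_b1.
  rewrite /cut_fun; case: (p (cut (y x))); case: (p (cut x)) => /=;
    by rewrite ?subrr ?subr0 ?sub0r ?normrN ?normr1 ?normr0.
- by rewrite big1_seq ?normr0 ?ler01// => x /andP[_ /sp]; exact: h0.
Qed.

(** Each jump contributes more than 1/4 to a sum bounded by [B], so more than [4 * B] jumps are
    impossible. *)
Lemma finite_jump : finite_set (jump (fun x => nu (cutC x))).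
Proof.
apply: contrapT => /(@infinite_set_fset _ _ (Num.truncn (4 * B)).+1)[A AD sA].
have [m sm] := mkseq_separate (finmap.enum_fset A).
have /choice[y yP] : forall x, exists y, x \in finmap.enum_fset A ->
    mkseq y m = mkseq x m /\ 4^-1 < `|nu (cutC y) - nu (cutC x)|.
  move=> x; have [xA|xA] := boolP (x \in finmap.enum_fset A).
    by have [y yP] := AD x xA m; exists y.
  by exists x.
have := @jump_sum_le _ y m (finmap.fset_uniq A) sm (fun x xA => (yP x xA).1).
apply/negP; rewrite -ltNge.
have : B < \sum_(x <- finmap.enum_fset A) 4^-1.
  rewrite big_const_seq count_predT iter_addr_0.
  rewrite -[ltRHS]mulr_natl ltr_pdivlMr// mulrC.
  by apply: lt_le_trans (truncnS_gt _) _; rewrite ler_nat.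
move=> /lt_le_trans; apply; rewrite big_seq [leRHS]big_seq.
by apply: ler_sum => x xA; apply/ltW; have [] := yP x xA.
Qed.

End NotSmooth.

(** * Excluding a bounded projection *)

Local Open Scope ring_scope.

Lemma tree_not_smooth (R : realType) (b : nat -> seq bool)
    (b_inj : injective b) (b_surj : forall t, exists n, b n = t) :
  ~ smooth R (tree_compactification b_inj b_surj).
Proof.
move=> [P [[M PM] PP rP]]; set gw := tree_compactification _ _ in P PM PP rP.
pose V := Cspace R (@comp_compact _ gw).
pose eve t (g : V) : R := @Ceval R b b_inj b_surj (emb t) g.
pose nu t (g : V) : R := eve t g - eve t (P g).
have nu_c0 t g : c0_copy R gw g -> nu t g = 0.
  by rewrite -rP => -[h _ <-]; rewrite /nu PP subrr.
(* The 1 bounds the value of [g], and [M], whose sign is unknown, enters through its absolute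
   value. *)
have nu_le t g : (forall p, `|@Ceval R b b_inj b_surj p g| <= 1) ->
    `|nu t g| <= 1 + `|M|.
  move=> g1; apply: le_trans (ler_normB _ _) _; apply: lerD; first exact: g1.
  apply: le_trans (sup_norm_ub (@comp_compact _ gw) (P g) (emb t)) _.
  apply: le_trans (PM g) _; apply: le_trans (ler_norm _) _; rewrite normrM.
  rewrite -[leRHS]mulr1 ler_wpM2l// normr_id.
  exact: sup_norm_le.
apply: (@fusion R (fun t x => nu t (cutC R b_inj b_surj x))) => [t|x].
  apply: finite_set_countable.
  apply: (@finite_jump R b b_inj b_surj (nu t) (1 + `|M|)) => [g h|g h|a g|g|g].
  - by rewrite /nu raddfB /eve !CevalB; lra.
  - by rewrite /nu raddfD /eve !CevalD; lra.
  - by rewrite /nu linearZ /eve !CevalZ mulrBr.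
  - exact: nu_c0.
  - exact: nu_le.
(* Along [x] the cut function is constantly [evens1 x], while its projection tends to the value at
   the limit [p], which is 0 because [p] lies in the remainder. *)
have [p ip xp] := emb_cvg x.
set g := cutC _ _ _ x.
have Pg : P g \in c0_copy R gw by apply/mem_set; rewrite -rP; exists g.
have Pg0 : (P g : continuousType gw R) p = 0.
  by apply: (set_mem Pg); exact/remainderE.
have Pgc : eve (mkseq x n) (P g) @[n --> \oo] --> (0 : R).
  rewrite -Pg0.
  exact: (cvg_comp _ _ xp (@cts_fun _ _ (P g : continuousType gw R) p)).
have -> : (fun n => nu (mkseq x n) g) =
    (fun n => (evens1 x)%:R - eve (mkseq x n) (P g)).
  by apply/funext => n; rewrite /nu -(lexset_mkseq x n).
rewrite -[X in _ --> X]subr0.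
by apply: cvgB => //; exact: cvg_cst.
Qed.

Theorem theorem7p1 (R : realType) :
  exists gw : compactification nat,
    [/\ ~ smooth R gw, first_countable gw
      & separable (set_type (remainder gw))].
Proof.
have [b [b_inj b_surj]] := tree_bij.
exists (tree_compactification b_inj b_surj); split; first last.
- exact: tree_remainder_separable.
- exact: tree_first_countable.
exact: tree_not_smooth.
Qed.
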